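(* Let $t\geq 3$ and $k\geq 1$ be odd integers and let $G=D(1,t)$. Then $\mathrm{rl}_k(G)\leq \frac t2 k^2-\frac12$.
   Context: For a finite set $D=\{d_1<\dots<d_m\}$ of positive integers, the distance graph $D(d_1,\dots,d_m)$ has vertex set $\mathbb{Z}$, two distinct integers $i,j$ being adjacent iff $|i-j|\in D$. For a connected graph $G$ with graph distance $d(\cdot,\cdot)$ and an integer $k\ge 1$, a radio $k$-labeling of $G$ is a map $c:V(G)\to\mathbb{Z}_{\ge 0}$ such that $|c(u)-c(v)|\geq k+1-d(u,v)$ for all distinct vertices $u,v$. Its span is $\max\{c(x)-c(y): x,y\in V(G)\}$ (a supremum for infinite graphs), and the radio $k$-labeling number $\mathrm{rl}_k(G)$ is the minimum span over all radio $k$-labelings of $G$. *)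

(* Defs.v *)
From HB Require Import structures.
From mathcomp Require Import all_boot all_order all_algebra.

Set Implicit Arguments.
Unset Strict Implicit.
Unset Printing Implicit Defensive.

Import Order.TTheory GRing.Theory Num.Theory.
Local Open Scope ring_scope.

Record sgraph (V : Type) := SGraph {
  adj :> rel V;
  adj_sym : symmetric adj;
  adj_irr : irreflexive adj }.

Definition dist_adj (D : seq nat) : rel int :=
  fun i j => (i != j) && (`|i - j|%N \in D).

Lemma dist_adj_sym (D : seq nat) : symmetric (dist_adj D).
Proof. by move=> i j; rewrite /dist_adj eq_sym distnC. Qed.

Lemma dist_adj_irr (D : seq nat) : irreflexive (dist_adj D).
Proof. by move=> i; rewrite /dist_adj eqxx. Qed.

Definition distance_graph (D : seq nat) : sgraph int :=
  SGraph (@dist_adj_sym D) (@dist_adj_irr D).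

Section RadioLabeling.
Variables (V : Type) (G : sgraph V).

Definition walk (u v : V) (n : nat) : Prop :=
  exists p : seq V, [/\ path G u p, last u p = v & size p = n].

Definition connected : Prop := forall u v : V, exists n, walk u v n.

(* [is_gdist u v n] : the graph distance d(u, v) is defined and equals n. *)
Definition is_gdist (u v : V) (n : nat) : Prop :=
  walk u v n /\ forall m, walk u v m -> (n <= m)%N.

Definition radio_labeling (k : nat) (c : V -> nat) : Prop :=
  forall u v : V, u <> v -> forall d : nat, is_gdist u v d ->
    k%:Z + 1 - d%:Z <= `|(c u)%:Z - (c v)%:Z|.

Definition span_bound (c : V -> nat) (s : nat) : Prop :=
  forall x y : V, (c x)%:Z - (c y)%:Z <= s%:Z.

(* [is_span c s] : the span of c is finite and equals s.  No natural number
   is the span of an unbounded labeling. *)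
Definition is_span (c : V -> nat) (s : nat) : Prop :=
  span_bound c s /\ forall s', span_bound c s' -> (s <= s')%N.

(* [is_rl k r] : rl_k(G) is finite and equals r. *)
Definition is_rl (k r : nat) : Prop :=
  (exists c : V -> nat, radio_labeling k c /\ is_span c r) /\
  (forall (c : V -> nat) (s : nat), radio_labeling k c -> is_span c s ->
     (r <= s)%N).

Lemma is_gdist_uniq (u v : V) (m n : nat) :
  is_gdist u v m -> is_gdist u v n -> m = n.
Proof.
move=> [wm hm] [wn hn]; apply/eqP.
by rewrite eqn_leq (hm _ wn) (hn _ wm).
Qed.

Lemma is_span_uniq (c : V -> nat) (m n : nat) :
  is_span c m -> is_span c n -> m = n.
Proof.
move=> [bm hm] [bn hn]; apply/eqP.
by rewrite eqn_leq (hm _ bn) (hn _ bm).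
Qed.

Lemma is_rl_uniq (k m n : nat) : is_rl k m -> is_rl k n -> m = n.
Proof.
move=> [[c [rc sc]] hm] [[c' [rc' sc']] hn]; apply/eqP.
by rewrite eqn_leq (hm _ _ rc' sc') (hn _ _ rc sc).
Qed.

End RadioLabeling.

Lemma walk_rcons (V : Type) (G : sgraph V) (u v w : V) (n : nat) :
  walk G u v n -> G v w -> walk G u w n.+1.
Proof.
move=> [p [hp hl hs]] hvw; exists (rcons p w).
by rewrite rcons_path hp hl hvw last_rcons size_rcons hs.
Qed.

Lemma distance_graph_connected (D : seq nat) :
  1%N \in D -> connected (distance_graph D).
Proof.
move=> D1 u v; rewrite -[v](subrK u) addrC.
have step (x y : int) : `|x - y|%N = 1%N -> distance_graph D x y.
  move=> h; rewrite /= /dist_adj h D1 andbT.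
  by apply/eqP => e; move: h; rewrite e subrr.
elim/int_rec: (v - u) => [|n [m hm]|n [m hm]].
- by exists 0%N, [::]; rewrite addr0.
- exists m.+1; apply: (walk_rcons hm); apply: step.
  by rewrite opprD addrACA subrr add0r -addn1 PoszD opprD addrA subrr add0r.
- exists m.+1; apply: (walk_rcons hm); apply: step.
  by rewrite opprD addrACA subrr add0r opprK -addn1 PoszD addKr.
Qed.

(* Main.v *)
Require Import Defs.
From HB Require Import structures.
From mathcomp Require Import all_boot all_order all_algebra.
From mathcomp Require Import zify ring lra.
From Stdlib Require Import Classical.

(** Put [2 N = t k^2 + 1] and label [i] by [k i mod N], which has span at most
    [N - 1 = (t k^2 - 1) / 2].  Since [k * (t k) = -1] modulo [N], two vertices
    whose labels differ by [s] lie at a difference [+/- s t k - j N] for some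
    integer [j].  Writing such a difference as [a t + b] in all possible ways,
    a case analysis on [j] shows [|a| + |b| + s >= k + 1]; and the length of any
    walk joining the two vertices is at least some such [|a| + |b|]. *)

Import Order.TTheory GRing.Theory Num.Theory.
Local Open Scope ring_scope.

Set Implicit Arguments.
Unset Strict Implicit.

(** Excluded middle stands in for decidability: [P] will speak of bounds and spans of labelings of
    an infinite graph. *)
Lemma ex_min_nat (P : nat -> Prop) :
  (exists n, P n) -> exists n, P n /\ forall m, P m -> (n <= m)%N.
Proof.
case=> n; elim/ltn_ind: n => n IH Pn.
have [[m [ltmn Pm]]|noless] := classic (exists m, (m < n)%N /\ P m).
  exact: IH ltmn Pm.
exists n; split=> // m Pm; rewrite leqNgt; apply/negP => ltmn.
by apply: noless; exists m.
Qed.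

(** The least bound of [c] is its span, so the set of spans of radio labelings is nonempty and has a
    least element. *)
Lemma is_rl_le (V : Type) (G : sgraph V) (k b : nat) (c : V -> nat) :
  radio_labeling G k c -> span_bound c b ->
  exists r, is_rl G k r /\ (r <= b)%N.
Proof.
move=> rc cb.
have [s [sb smin]] := @ex_min_nat (span_bound c) (ex_intro _ b cb).
have [|r [[c' [rc' sc']] rmin]] := @ex_min_nat
    (fun r => exists c', radio_labeling G k c' /\ is_span c' r).
  by exists s, c.
exists r; split; last first.
  apply: leq_trans (smin _ cb); apply: rmin.
  by exists c.
split; first by exists c'.
by move=> c'' s'' rc'' sc''; apply: rmin; exists c''.
Qed.

(** Each edge of the walk changes exactly one of [a] and [b], by one. *)
Lemma walk_decomp (t : nat) (u v : int) (n : nat) :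
  walk (distance_graph [:: 1%N; t]) u v n ->
  exists a b : int, v - u = a * t%:Z + b /\ `|a| + `|b| <= n%:Z.
Proof.
case=> p []; elim: p u n => [|w p IH] u n /=.
  by move=> _ <- <-; exists 0, 0; split; lia.
case/andP=> /andP[_]; rewrite !inE => uw /IH{}IH lastp.
case: n => // n [szp]; have [a [b [vw ab]]] := IH _ lastp szp.
have [uw1|uwt] := orP uw.
  by exists a, (b + (w - u)); split; lia.
have [leuw|/ltW lewu] := lerP u w.
  by exists (a + 1), b; split; lia.
by exists (a - 1), b; split; lia.
Qed.

(* For [a t + b = s t k - j N], put [e := 2 s k - j k^2 - 2 a]; then
   [2 b = t e - j], so the right-hand side is [|2 a| + |2 b|], and [e] and [j]
   have the same parity because [t] is odd. *)
Lemma radio_ineq (t k s j e : int) :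
  3 <= t -> 1 <= k -> 0 <= s -> s <= k ->
  (exists i : int, k = 2 * i + 1) -> (exists i : int, e - j = 2 * i) ->
  (j = 0 -> 1 <= s) ->
  2 * k + 2 - 2 * s <= `|2 * s * k - j * k ^+ 2 - e| + `|t * e - j|.
Proof.
move=> t3 k1 s0 sk [h kh] [i ej] js.
have kk : k <= k ^+ 2 by nia.
have te : 3 * `|e| <= `|t * e| by rewrite normrM; nia.
have tep : 0 <= e -> 3 * e <= t * e by nia.
have ten : e <= 0 -> t * e <= 3 * e by nia.
have sk0 : 0 <= s * k by nia.
have [jN|[j0|[j1|j2]]] : j <= -1 \/ j = 0 \/ j = 1 \/ 2 <= j by lia.
- have [jm1|[jm2|jm3]] : j = -1 \/ j = -2 \/ j <= -3 by lia.
  (* Here [e] is odd, hence [|t * e + 1| - e >= 3]. *)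
  + have : 2 * k <= k ^+ 2 + 1 by nia.
    by subst j; lia.
  + by subst j; lia.
  + have : 3 * k ^+ 2 <= - j * k ^+ 2 by nia.
    have : 1 <= `|e| + `|t * e - j| by lia.
    by lia.
- have : k <= s * k by have := js j0; nia.
  by have := js j0; subst j; lia.
- subst j.
  (* As [k] is odd, [2 * s] differs from [k]; as [e] is odd, [|t * e - 1| >= |e| + 1]. *)
  have [le|gt] : 2 * s + 1 <= k \/ k + 1 <= 2 * s by lia.
    have : k + (k - 2 * s) - 1 <= k * (k - 2 * s) by nia.
    by lia.
  have : k + 1 - (2 * s - k) <= k * (2 * s - k) by nia.
  by lia.
(* Here [j * k ^+ 2 - 2 * s * k = (j - 2) * k ^+ 2 + 2 * k * (k - s)], and
   [e + |t * e - j| + j >= 4]. *)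
- have : j - 2 <= (j - 2) * k ^+ 2 by nia.
  have : k - s <= k * (k - s) by nia.
  by lia.
Qed.

Lemma radio_ineq_mod (t k N a b s l : int) :
  3 <= t -> 1 <= k -> (exists i : int, t = 2 * i + 1) ->
  (exists i : int, k = 2 * i + 1) -> 2 * N = t * k ^+ 2 + 1 ->
  0 <= s -> a * t + b != 0 -> s = l * N - k * (a * t + b) ->
  k + 1 <= s + `|a| + `|b|.
Proof.
move=> t3 k1 [h tE] k_odd NE s0; set n := a * t + b => n0 sE.
have [ltks|lesk] := ltrP k s; first by lia.
(* Multiplying [sE] by [t * k] and replacing [t * k ^+ 2] by [2 * N - 1] gives [nE] with this
   [j]. *)
pose j := l * t * k - 2 * n.
have nE : n = s * t * k - j * N.
  have := congr1 (fun x => x * n) NE.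
  have := congr1 (fun x => x * t * k) sE.
  by rewrite /= /j; lia.
pose e := 2 * s * k - j * k ^+ 2 - 2 * a.
have bE : 2 * b = t * e - j.
  have := congr1 (fun x => x * j) NE.
  by move: nE; rewrite /= /e {1}/n; lia.
have ej : exists i : int, e - j = 2 * i.
  by exists (b - h * e); move: bE; rewrite tE; lia.
have js : j = 0 -> 1 <= s.
  move=> j0; have [//|s1] := lerP 1 s; have sz : s = 0 by lia.
  by case/eqP: n0; rewrite nE j0 sz !mul0r subrr.
have := radio_ineq t3 k1 s0 lesk k_odd ej js.
rewrite -bE (_ : _ - e = 2 * a); first by lia.
by rewrite /e; ring.
Qed.

Lemma radio_labeling_modn (t k N : nat) :
  (3 <= t)%N -> odd t -> odd k -> (2 * N = t * k ^ 2 + 1)%N ->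
  radio_labeling (distance_graph [:: 1%N; t]) k
    (fun i : int => `|(k%:Z * i %% N%:Z)%Z|%N).
Proof.
move=> t3 t_odd k_odd NE u v uv d [/walk_decomp [a [b [vu ab]]] _].
have N0 : N%:Z != 0 by nia.
rewrite !gez0_abs ?modz_ge0 //; set S := (X in _ <= `|X|).
have {}NE : 2 * N%:Z = t%:Z * k%:Z ^+ 2 + 1 by lia.
have [l SE] : exists l, S = l * N%:Z - k%:Z * (a * t%:Z + b).
  exists ((k%:Z * v %/ N%:Z)%Z - (k%:Z * u %/ N%:Z)%Z).
  by rewrite -vu /S /modz; ring.
have n0 : a * t%:Z + b != 0.
  by rewrite -vu subr_eq0; apply/eqP => vEu; apply: uv.
have oddE m : odd m -> exists i : int, m%:Z = 2 * i + 1.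
  by exists m./2%:Z; lia.
have t3' : 3 <= t%:Z by [].
have k1 : 1 <= k%:Z by lia.
have t_oddz := oddE _ t_odd; have k_oddz := oddE _ k_odd.
have bound := radio_ineq_mod t3' k1 t_oddz k_oddz NE.
have [S0|/ltW S0] := lerP 0 S.
  by have := bound _ _ _ _ S0 n0 SE; lia.
(* Exchanging [u] and [v] negates [S], [a], [b] and [l]. *)
have : k%:Z + 1 <= - S + `|- a| + `|- b|.
  apply: (bound _ _ _ (- l)); first by lia.
    by rewrite mulNr -opprD oppr_eq0.
  by rewrite SE; ring.
by rewrite !normrN; lia.
Qed.

Theorem theorem4 (t k : nat) (ht : (3 <= t)%N) (hk : (1 <= k)%N)
    (t_odd : odd t) (k_odd : odd k) :
  exists r : nat, is_rl (distance_graph [:: 1%N; t]) k r /\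
    r%:R <= t%:R / 2 * k%:R ^+ 2 - 1 / 2 :> rat.
Proof.
have [N NE] : exists N, (2 * N = t * k ^ 2 + 1)%N.
  exists ((t * k ^ 2).+1./2); rewrite mul2n addn1 halfK /=.
  by rewrite oddM oddX t_odd k_odd subn0.
have N0 : N%:Z != 0 by nia.
(* Residues modulo [N] differ by at most [N - 1], and [2 * (N - 1) = t * k ^ 2 - 1]. *)
have [|r [rlr rN]] := is_rl_le (b := N.-1) (radio_labeling_modn ht t_odd k_odd NE).
  move=> x y.
  have := modz_ge0 (k%:Z * x) N0; have := modz_ge0 (k%:Z * y) N0.
  by have := @ltz_mod (k%:Z * x) _ N0; lia.
exists r; split=> //.
have : (2 * r)%:R + 1 <= (t * k ^ 2)%:R :> rat.
  by rewrite natr1 ler_nat; lia.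
by rewrite !natrM; lra.
Qed.
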